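(* Let $n, m, p, L, q$ be positive integers, and let $A \in \mathbb{R}^{n\times n}$, $B \in \mathbb{R}^{n\times m}$, $C \in \mathbb{R}^{p\times n}$, $D \in \mathbb{R}^{p\times m}$. Consider the discrete-time linear time-invariant system $$\mathbf{x}(t+1) = A\mathbf{x}(t) + B\mathbf{u}(t), \qquad \mathbf{y}(t) = C\mathbf{x}(t) + D\mathbf{u}(t), \qquad (\Sigma)$$ and assume that the pair $(A,B)$ is controllable. For $i = 1,2,\dots,q$, let $(u^i_{[0,T_i-1]}, x^i_{[0,T_i-1]}, y^i_{[0,T_i-1]})$ be an input/state/output trajectory of $(\Sigma)$ of length $T_i$. Assume that the inputs $u^i_{[0,T_i-1]}$, $i=1,\dots,q$, are collectively persistently exciting of order $n+L$ (which includes $n+L \le T_i$ for all $i$). Then the following statements hold: (i) The matrix $$\begin{bmatrix} \mathcal{H}_{1}(x^1_{[0,T_1-L]}) & \mathcal{H}_{1}(x^2_{[0,T_2-L]}) & \cdots & \mathcal{H}_{1}(x^q_{[0,T_q-L]}) \\ \mathcal{H}_{L}(u^1_{[0,T_1-1]}) & \mathcal{H}_{L}(u^2_{[0,T_2-1]}) & \cdots & \mathcal{H}_{L}(u^q_{[0,T_q-1]}) \end{bmatrix}$$ has full row rank. (ii) Every length $L$ input/output trajectory of $(\Sigma)$ can be expressed in terms of $u^i_{[0,T_i-1]}$ and $y^i_{[0,T_i-1]}$ ($i=1,\dots,q$) as follows: $(\bar{u}_{[0,L-1]}, \bar{y}_{[0,L-1]})$ is an input/output trajectory of $(\Sigma)$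 if and only if $$\begin{bmatrix} \bar{u}_{[0,L-1]} \\ \bar{y}_{[0,L-1]} \end{bmatrix} = \begin{bmatrix} \mathcal{H}_{L}(u^1_{[0,T_1-1]}) & \cdots & \mathcal{H}_{L}(u^q_{[0,T_q-1]}) \\ \mathcal{H}_{L}(y^1_{[0,T_1-1]}) & \cdots & \mathcal{H}_{L}(y^q_{[0,T_q-1]}) \end{bmatrix} g$$ for some real vector $g$.
   Context: Notation. For a vector-valued signal $f$ and integers $i \le j$, $f_{[i,j]}$ denotes both the sequence $f(i), f(i+1), \dots, f(j)$ and the stacked column vector $\begin{bmatrix} f(i)^\top & f(i+1)^\top & \cdots & f(j)^\top \end{bmatrix}^\top$. Hankel matrix. For a positive integer $k \le j-i+1$, the Hankel matrix of depth $k$ (with $k$ block rows) associated with $f_{[i,j]}$ is $$\mathcal{H}_{k}(f_{[i,j]}) := \begin{bmatrix} f(i) & f(i+1) & \cdots & f(j-k+1) \\ f(i+1) & f(i+2) & \cdots & f(j-k+2) \\ \vdots & \vdots & & \vdots \\ f(i+k-1) & f(i+k) & \cdots & f(j) \end{bmatrix}.$$ In particular $\mathcal{H}_1(f_{[i,j]}) = \begin{bmatrix} f(i) & f(i+1) & \cdots & f(j)\end{bmatrix}$. Trajectories. The signals take values $\mathbf{u}(t)\in\mathbb{R}^m$ (input), $\mathbf{x}(t)\in\mathbb{R}^n$ (state), $\mathbf{y}(t)\in\mathbb{R}^p$ (output). An input/state/output trajectory $(u_{[0,T-1]},x_{[0,T-1]},y_{[0,T-1]})$ of length $T$ of the system is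 a triple of finite sequences satisfying $x(t+1)=Ax(t)+Bu(t)$ for $0\le t\le T-2$ and $y(t)=Cx(t)+Du(t)$ for $0\le t\le T-1$. A pair $(u_{[0,T-1]},y_{[0,T-1]})$ is an input/output trajectory of length $T$ if there is a state sequence $x_{[0,T-1]}$ (with arbitrary initial state $x(0)\in\mathbb{R}^n$) making $(u_{[0,T-1]},x_{[0,T-1]},y_{[0,T-1]})$ an input/state/output trajectory. Controllability. $(A,B)$ is controllable if $\begin{bmatrix} B & AB & \cdots & A^{n-1}B\end{bmatrix}$ has rank $n$. Collective persistency of excitation. Let $k$ be a positive integer with $k \le T_i$ for all $i=1,\dots,q$. The input sequences $u^i_{[0,T_i-1]}$, $i=1,\dots,q$, are called collectively persistently exciting of order $k$ if the mosaic-Hankel matrix $$\begin{bmatrix} \mathcal{H}_{k}(u^1_{[0,T_1-1]}) & \mathcal{H}_{k}(u^2_{[0,T_2-1]}) & \cdots & \mathcal{H}_{k}(u^q_{[0,T_q-1]}) \end{bmatrix}$$ has full row rank. *)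

(* Defs.v *)
From HB Require Import structures.
From mathcomp Require Import all_boot all_order all_algebra.
From mathcomp Require Import reals.
Set Implicit Arguments.
Unset Strict Implicit.
Unset Printing Implicit Defensive.
Import GRing.Theory.
Local Open Scope ring_scope.

(* A finite sequence f(0), ..., f(T-1) is given by a function on nat together
   with its length T; every definition below only looks at the values f t with
   t < T, so the values beyond the length are irrelevant. *)
Definition signal (R : realType) (d : nat) := nat -> 'cV[R]_d.

(* The column vector f_{[0,k-1]}. *)
Definition stack (R : realType) (d k : nat) (f : signal R d) :
    'cV[R]_(\sum_(a < k) d) :=
  \mxcol_(a < k) f a.

(* The parameter N is the number of columns: hankel k N f is
   H_k(f_{[0,k+N-2]}), so that H_k(f_{[0,T-1]}) is hankel k (T - k).+1 f for
   k <= T, and H_1(f_{[0,T-L]}) is hankel 1 (T - L).+1 f for L <= T.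
   Indexing by N rather than by T makes the column counts of these two agree
   definitionally. *)
Definition hankel (R : realType) (d k N : nat) (f : signal R d) :
    'M[R]_(\sum_(a < k) d, N) :=
  \mxcol_(a < k) \matrix_(r < d, b < N) f (a + b)%N r 0.

Definition mosaic_hankel (R : realType) (d q k : nat) (N : 'I_q -> nat)
    (f : 'I_q -> signal R d) :
    'M[R]_(\sum_(a < k) d, \sum_(i < q) N i) :=
  \mxrow_(i < q) hankel k (N i) (f i).

Definition ctrb_mx (R : realType) (n m : nat) (A : 'M[R]_n) (B : 'M[R]_(n, m)) :
    'M[R]_(n, \sum_(k < n) m) :=
  \mxrow_(k < n) (A ^+ k *m B).

Definition controllable (R : realType) (n m : nat)
    (A : 'M[R]_n) (B : 'M[R]_(n, m)) : Prop :=
  \rank (ctrb_mx A B) = n.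

Definition iso_trajectory (R : realType) (n m p : nat)
    (A : 'M[R]_n) (B : 'M[R]_(n, m)) (C : 'M[R]_(p, n)) (D : 'M[R]_(p, m))
    (T : nat) (u : signal R m) (x : signal R n) (y : signal R p) : Prop :=
  (forall t, (t.+1 < T)%N -> x t.+1 = A *m x t + B *m u t) /\
  (forall t, (t < T)%N -> y t = C *m x t + D *m u t).

Definition io_trajectory (R : realType) (n m p : nat)
    (A : 'M[R]_n) (B : 'M[R]_(n, m)) (C : 'M[R]_(p, n)) (D : 'M[R]_(p, m))
    (T : nat) (u : signal R m) (y : signal R p) : Prop :=
  exists x : signal R n, iso_trajectory A B C D T u x y.

Definition collectively_pe (R : realType) (m q k : nat) (T : 'I_q -> nat)
    (u : 'I_q -> signal R m) : Prop :=
  [/\ (0 < k)%N, forall i, (k <= T i)%N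
    & row_free (mosaic_hankel k (fun i => (T i - k).+1) u)].

(* Main.v *)
(* Suppose (xi, eta) annihilates the state/input matrix from the left. Shifting
   this relation by k = 0, ..., n time steps and eliminating the states gives
   xi A^k x(t) + (a combination of u(t), ..., u(t+n+L-1)) = 0. Combining these
   n+1 relations with the coefficients of the characteristic polynomial of A
   kills the state term by Cayley-Hamilton, so by persistency of excitation the
   combined input coefficients vanish. As the polynomial is monic, they form a
   recursion that, read from the last coefficient down, gives eta = 0 and
   xi A^k B = 0 for k < n; controllability then gives xi = 0. For (ii), windows
   of the data combine linearly to trajectories, and by (i) every initial state
   and input sequence is attained by such a combination. *)

Require Import Defs.
From HB Require Import structures.
From mathcomp Require Import all_boot all_order all_algebra.
From mathcomp Require Import reals.
From mathcomp Require Import zify.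
Set Implicit Arguments.
Unset Strict Implicit.
Unset Printing Implicit Defensive.
Import GRing.Theory.
Local Open Scope ring_scope.

Lemma Cayley_Hamilton_sum (R : comNzRingType) (n : nat) (A : 'M[R]_n) :
  \sum_(k < n.+1) (char_poly A)`_k *: A ^+ k = 0.
Proof.
case: n A => [|n] A; first by apply/matrixP => - [].
rewrite -[RHS](Cayley_Hamilton A) /horner_mx /horner_morph.
rewrite (@horner_coef_wide _ n.+2); last first.
  by rewrite (leq_trans (size_poly _ _)) ?size_char_poly.
by apply: eq_bigr => k _; rewrite coef_map /= -mul_scalar_mx.
Qed.

Lemma row_free_mxcol_eq0 (F : fieldType) (k d c : nat)
    (U : 'I_k -> 'M[F]_(d, c)) (w : 'I_k -> 'rV[F]_d) :
  row_free (\mxcol_(j < k) U j) -> \sum_(j < k) w j *m U j = 0 ->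
  forall j, w j = 0.
Proof.
move=> freeU; rewrite -mul_mxrow_mxcol => /eqP.
rewrite mulmx_free_eq0 // => /eqP w0 j.
by rewrite -(mxrowK w j) w0 submxrow0.
Qed.

Lemma controllable_row_eq0 (R : realType) (n m : nat) (A : 'M[R]_n)
    (B : 'M[R]_(n, m)) (xi : 'rV[R]_n) :
  controllable A B -> (forall k, (k < n)%N -> xi *m A ^+ k *m B = 0) -> xi = 0.
Proof.
move=> ctrlAB xi0; apply/eqP.
have freeC : row_free (ctrb_mx A B) by apply/eqP.
rewrite -(mulmx_free_eq0 _ freeC) mul_mxrow; apply/eqP.
rewrite -[RHS]mxrow0; apply: eq_mxrow => k.
by rewrite mulmxA xi0.
Qed.

(** Variation of constants. [X] and [U] are matrix-valued so that one application covers all data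
    windows, one per column. *)
Lemma state_response (R : pzRingType) (n m c l : nat) (A : 'M[R]_n)
    (B : 'M[R]_(n, m)) (X : nat -> 'M[R]_(n, c)) (U : nat -> 'M[R]_(m, c)) :
  (forall k, (k < l)%N -> X k.+1 = A *m X k + B *m U k) ->
  forall k, (k <= l)%N ->
  X k = A ^+ k *m X 0 + \sum_(0 <= j < k) A ^+ (k.-1 - j) *m B *m U j.
Proof.
move=> XS; elim=> [|k IH] lekl.
  by rewrite big_geq // expr0 mul1mx addr0.
rewrite XS // IH 1?ltnW // mulmxDr mulmxA -addrA; congr (_ *m _ + _).
  by rewrite exprS.
rewrite big_nat_recr //= subnn expr0 mul1mx; congr (_ + _).
rewrite mulmx_sumr; apply: eq_big_nat => j /andP[_ ltjk].
rewrite !mulmxA; congr (_ *m _ *m _).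
by case: k ltjk {IH lekl} => // k ltjk; rewrite subSn // exprS.
Qed.

(* The list [xi *m A ^+ n.-1 *m B, ..., xi *m B, eta 0, ..., eta L.-1], padded
   with zeros. Eliminating the state from [xi *m X k + \sum_a eta a *m U (k + a)]
   leaves [U 0], ..., [U (n + L - 1)] with this list shifted left by [n - k] as
   coefficients. *)
Definition annihilator_seq (R : realType) (n m L : nat) (A : 'M[R]_n)
    (B : 'M[R]_(n, m)) (xi : 'rV[R]_n) (eta : nat -> 'rV[R]_m) (s : nat) :=
  if (s < n)%N then xi *m A ^+ (n.-1 - s) *m B
  else if (s < n + L)%N then eta (s - n)%N else 0.

Lemma annihilator_seq_sum (R : realType) (n m L c : nat) (A : 'M[R]_n)
    (B : 'M[R]_(n, m)) (X : nat -> 'M[R]_(n, c)) (U : nat -> 'M[R]_(m, c))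
    (xi : 'rV[R]_n) (eta : nat -> 'rV[R]_m) (k : nat) :
  (forall k, (k < n)%N -> X k.+1 = A *m X k + B *m U k) -> (k <= n)%N ->
  xi *m X k + \sum_(a < L) eta a *m U (k + a)%N =
  xi *m A ^+ k *m X 0 +
  \sum_(j < n + L) annihilator_seq L A B xi eta (n + j - k) *m U j.
Proof.
move=> XS lekn; rewrite (state_response XS lekn) mulmxDr mulmxA -addrA.
congr (_ + _).
rewrite -(big_mkord xpredT
  (fun j => annihilator_seq L A B xi eta (n + j - k) *m U j)).
have leknL : (k <= n + L)%N by rewrite (leq_trans lekn) ?leq_addr.
(* The sum is cut at [k] and [k + L]: first the input terms of the state response, then the [eta]
   terms, then the zero padding. *)
rewrite [RHS](big_cat_nat (n := k)) //=.
congr (_ + _).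
  rewrite mulmx_sumr; apply: eq_big_nat => j /andP[_ ltjk].
  rewrite /annihilator_seq ifT; last lia.
  rewrite !mulmxA; congr (_ *m _ ^+ _ *m _ *m _).
  lia.
rewrite [RHS](big_cat_nat (n := k + L)) ?leq_addr ?leq_add2r //=.
rewrite [X in _ = _ + X]big_nat [X in _ = _ + X]big1 ?addr0; last first.
  move=> j /andP[lekj _]; rewrite /annihilator_seq !ifF ?mul0mx //; lia.
rewrite -[X in index_iota X]add0n big_addn addKn big_mkord.
apply: eq_bigr => a _; rewrite /annihilator_seq ifF; last lia.
rewrite ifT; last by have := ltn_ord a; lia.
by rewrite [(k + a)%N]addnC; congr (eta _ *m _); lia.
Qed.

Lemma left_annihilator_eq0 (R : realType) (n m L c : nat) (A : 'M[R]_n)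
    (B : 'M[R]_(n, m)) (X : nat -> 'M[R]_(n, c)) (U : nat -> 'M[R]_(m, c))
    (xi : 'rV[R]_n) (eta : nat -> 'rV[R]_m) :
  controllable A B ->
  (forall k, (k < n)%N -> X k.+1 = A *m X k + B *m U k) ->
  row_free (\mxcol_(j < n + L) U j) ->
  (forall k, (k <= n)%N ->
     xi *m X k + \sum_(a < L) eta a *m U (k + a)%N = 0) ->
  xi = 0 /\ forall a, (a < L)%N -> eta a = 0.
Proof.
move=> ctrlAB XS freeU ann0; set v := annihilator_seq L A B xi eta.
have vrec (j : 'I_(n + L)) :
    \sum_(k < n.+1) (char_poly A)`_k *: v (n + j - k)%N = 0.
  apply: (row_free_mxcol_eq0
    (w := fun j => \sum_(k < n.+1) (char_poly A)`_k *: v (n + j - k)%N) freeU).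
  under eq_bigr do rewrite mulmx_suml.
  rewrite exchange_big /=.
  (* Inserting the terms in [X 0] changes nothing: weighted by the characteristic polynomial, they
     sum to zero by Cayley-Hamilton. Each bracket then equals the left side of a relation in
     [ann0]. *)
  transitivity (\sum_(k < n.+1) (char_poly A)`_k *:
      (xi *m A ^+ k *m X 0 + \sum_(j < n + L) v (n + j - k)%N *m U j)).
    under [RHS]eq_bigr do rewrite scalerDr.
    rewrite big_split /= [X in _ = X + _](_ : _ = 0) ?add0r.
      apply: eq_bigr => k _; rewrite scaler_sumr.
      by apply: eq_bigr => a _; rewrite scalemxAl.
    under eq_bigr do rewrite scalemxAl scalemxAr.
    by rewrite -mulmx_suml -mulmx_sumr Cayley_Hamilton_sum mulmx0 mul0mx.
  rewrite big1 // => k _.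
  have lekn : (k <= n)%N by rewrite -ltnS.
  by rewrite -(annihilator_seq_sum _ _ _ XS lekn) ann0 // scaler0.
have lead1 : (char_poly A)`_n = 1.
  have /monicP := char_poly_monic A.
  by rewrite lead_coefE size_char_poly.
(* Downward induction on [s], starting in the padding [s >= n + L]. In [vrec] at [s], the monic term
   [k = n] is [v s], while each [k < n] gives an entry of larger index [n + s - k]. *)
have v0 s : v s = 0.
  have [d] := ubnP (n + L - s); elim: d s => // d IH s led.
  have [leLs|ltsL] := leqP (n + L) s.
    by rewrite /v /annihilator_seq !ifF //; lia.
  have := vrec (Ordinal ltsL).
  rewrite big_ord_recr /= lead1 scale1r addKn big1 ?add0r // => k _.
  by rewrite IH ?scaler0 //; have := ltn_ord k; lia.
split.
  apply: (controllable_row_eq0 ctrlAB) => k ltkn.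
  have := v0 (n.-1 - k)%N; rewrite /v /annihilator_seq ifT; last lia.
  by rewrite subKn //; lia.
move=> a ltaL; have := v0 (n + a)%N.
by rewrite /v /annihilator_seq ifF ?ifT ?addKn //; lia.
Qed.

(** Block row [a] of the mosaic-Hankel matrix. Indexing by [nat] lets [slice N f] serve as a
    matrix-valued signal obeying the system equations. *)
Definition slice (R : realType) (d q : nat) (N : 'I_q -> nat)
    (f : 'I_q -> signal R d) (a : nat) : 'M[R]_(d, \sum_(i < q) N i) :=
  \mxrow_(i < q) \matrix_(r < d, b < N i) f i (a + b)%N r 0.

Lemma mosaic_hankelE (R : realType) (d q k : nat) (N : 'I_q -> nat)
    (f : 'I_q -> signal R d) :
  mosaic_hankel k N f = \mxcol_(a < k) slice N f a.
Proof. by apply/matrixP => r s; rewrite !mxE. Qed.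

(** Inside block [i], column [b] of the shifted slice is column [k + b] of the original one. As [h]
    depends on neither [f] nor [a], a single column selection shifts a whole relation between states
    and inputs. *)
Lemma slice_shift (R : realType) (q k : nat) (N M : 'I_q -> nat) :
  (forall i, k + M i <= N i)%N ->
  exists h, forall d (f : 'I_q -> signal R d) a,
    slice M f (k + a) = colsub h (slice N f a).
Proof.
move=> leMN.
have ltMN i (b : 'I_(M i)) : (k + b < N i)%N.
  by rewrite (leq_trans _ (leMN i)) // ltn_add2l.
exists (fun s => tagnat.Rank (tagnat.sig1 s) (Ordinal (ltMN _ (tagnat.sig2 s)))).
move=> d f a; rewrite /slice; apply/matrixP => r s.
rewrite !mxE tagnat.Rank2K.
by case: _ / (esym _) => /=; rewrite addnCA addnA.
Qed.

Lemma slice_linear (R : realType) (d1 d2 d3 q a1 a2 a3 : nat)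
    (N : 'I_q -> nat) (G : 'M[R]_(d1, d2)) (H : 'M[R]_(d1, d3))
    (f : 'I_q -> signal R d1) (g : 'I_q -> signal R d2)
    (h : 'I_q -> signal R d3) :
  (forall i b, (b < N i)%N ->
     f i (a1 + b)%N = G *m g i (a2 + b)%N + H *m h i (a3 + b)%N) ->
  slice N f a1 = G *m slice N g a2 + H *m slice N h a3.
Proof.
move=> fE; rewrite /slice !mul_mxrow -mxrowD; apply: eq_mxrow => i.
apply/matrixP => r b; rewrite !mxE fE // !mxE.
by congr (_ + _); apply: eq_bigr => s _; rewrite !mxE.
Qed.

Lemma stack_eq_mosaic_mulP (R : realType) (d q k : nat) (N : 'I_q -> nat)
    (f : 'I_q -> signal R d) (fbar : signal R d)
    (g : 'cV[R]_(\sum_(i < q) N i)) :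
  stack k fbar = mosaic_hankel k N f *m g <->
  forall a, (a < k)%N -> fbar a = slice N f a *m g.
Proof.
rewrite mosaic_hankelE mxcol_mul /stack; split=> [/eq_mxcolP E a ltak|E].
  exact: (E (Ordinal ltak)).
by apply: eq_mxcol => a; apply: E.
Qed.

Lemma iso_trajectory_slice (R : realType) (n m p q L : nat)
    (A : 'M[R]_n) (B : 'M[R]_(n, m)) (C : 'M[R]_(p, n)) (D : 'M[R]_(p, m))
    (T N : 'I_q -> nat) (u : 'I_q -> signal R m) (x : 'I_q -> signal R n)
    (y : 'I_q -> signal R p) (g : 'cV[R]_(\sum_(i < q) N i)) :
  (forall i, iso_trajectory A B C D (T i) (u i) (x i) (y i)) ->
  (forall i, (N i + L <= (T i).+1)%N) ->
  iso_trajectory A B C D L (fun a => slice N u a *m g)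
    (fun a => slice N x a *m g) (fun a => slice N y a *m g).
Proof.
move=> traj leNT; split=> a ltaL; rewrite !mulmxA -mulmxDl; congr (_ *m _).
  apply: slice_linear => i b ltbN; rewrite addSn.
  by apply: (traj i).1; have := leNT i; lia.
apply: slice_linear => i b ltbN.
by apply: (traj i).2; have := leNT i; lia.
Qed.

(** Determinism, which identifies a given trajectory with a combination of data windows once initial
    states and inputs match. *)
Lemma iso_trajectory_eq (R : realType) (n m p L : nat)
    (A : 'M[R]_n) (B : 'M[R]_(n, m)) (C : 'M[R]_(p, n)) (D : 'M[R]_(p, m))
    (u u' : signal R m) (x x' : signal R n) (y y' : signal R p) :
  iso_trajectory A B C D L u x y -> iso_trajectory A B C D L u' x' y' ->
  x 0 = x' 0 -> (forall t, (t < L)%N -> u t = u' t) ->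
  forall t, (t < L)%N -> y t = y' t.
Proof.
move=> [xS yE] [x'S y'E] x0 uE.
have xE t : (t < L)%N -> x t = x' t.
  by elim: t => // t IH ltL; rewrite xS // x'S // IH ?uE // ltnW.
by move=> t ltL; rewrite yE // y'E // xE // uE.
Qed.

Lemma row_free_state_input (R : realType) (n m q L : nat) (A : 'M[R]_n)
    (B : 'M[R]_(n, m)) (T : 'I_q -> nat) (u : 'I_q -> signal R m)
    (x : 'I_q -> signal R n) :
  controllable A B ->
  (forall i t, (t.+1 < T i)%N -> x i t.+1 = A *m x i t + B *m u i t) ->
  (0 < L)%N -> collectively_pe (n + L) T u ->
  row_free (col_mx (mosaic_hankel 1 (fun i => (T i - L).+1) x)
                   (mosaic_hankel L (fun i => (T i - L).+1) u)).
Proof.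
move=> ctrlAB xS L_gt0 [_ leT freeU].
set N := fun i => (T i - L).+1; apply: inj_row_free => w.
rewrite -[w]hsubmxK mul_row_col !mosaic_hankelE.
rewrite -[lsubmx w]submxrowK -[rsubmx w]submxrowK !mul_mxrow_mxcol big_ord1.
set xi := submxrow _ _ => w0.
(* The [L] input blocks of [w], extended by zero to all of [nat]. *)
pose eta a := oapp (submxrow (rsubmx w)) 0 (insub a).
have etaE (a : 'I_L) : eta a = submxrow (rsubmx w) a by rewrite /eta valK.
(* Since [N i = n + M i], the first [M i] columns can be shifted by any [k <= n] without leaving the
   data; [M] is also the column count in the excitation hypothesis. *)
pose M i := (T i - (n + L)).+1.
have [|||xi0 eta0] := left_annihilator_eq0 (L := L) (X := slice M x)
    (U := slice M u) (xi := xi) (eta := eta) ctrlAB.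
- move=> k ltkn; apply: slice_linear => i b ltbM; rewrite addSn; apply: xS.
  by have := leT i; rewrite /M in ltbM; lia.
- by rewrite -mosaic_hankelE.
- move=> k lekn; have [|h hE] := @slice_shift R q k N M.
    by move=> i; rewrite /M /N; have := leT i; lia.
  rewrite -[X in slice M x X]addn0 hE.
  rewrite -[RHS](linear0 (mxsub id h)) -[in RHS]w0 linearD linear_sum.
  rewrite mulmx_colsub; congr (_ + _); apply: eq_bigr => a _.
  by rewrite hE etaE mulmx_colsub.
rewrite -[RHS]row_mx0; congr row_mx; rewrite -[RHS]mxrow0; apply: eq_mxrow => a.
  by rewrite [a]ord1; exact: xi0.
by rewrite -etaE eta0.
Qed.

Theorem theorem2 (R : realType) (n m p L q : nat)
    (n_gt0 : (0 < n)%N) (m_gt0 : (0 < m)%N) (p_gt0 : (0 < p)%N)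
    (L_gt0 : (0 < L)%N) (q_gt0 : (0 < q)%N)
    (A : 'M[R]_n) (B : 'M[R]_(n, m)) (C : 'M[R]_(p, n)) (D : 'M[R]_(p, m))
    (ctrlAB : controllable A B)
    (T : 'I_q -> nat) (u : 'I_q -> signal R m) (x : 'I_q -> signal R n)
    (y : 'I_q -> signal R p)
    (traj : forall i : 'I_q, iso_trajectory A B C D (T i) (u i) (x i) (y i))
    (cpe : collectively_pe (n + L) T u) :
  let N := fun i : 'I_q => (T i - L).+1 in
  row_free (col_mx (mosaic_hankel 1 N x) (mosaic_hankel L N u))
  /\
  (forall (ubar : signal R m) (ybar : signal R p),
     io_trajectory A B C D L ubar ybar <->
     exists g : 'cV[R]_(\sum_(i < q) N i),
       col_mx (stack L ubar) (stack L ybar) =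
       col_mx (mosaic_hankel L N u) (mosaic_hankel L N y) *m g).
Proof.
move=> N.
have [_ leT _] := cpe.
have freeXU : row_free (col_mx (mosaic_hankel 1 N x) (mosaic_hankel L N u)).
  exact: (row_free_state_input ctrlAB (fun i => (traj i).1)).
have sliceT g : iso_trajectory A B C D L (fun a => slice N u a *m g)
    (fun a => slice N x a *m g) (fun a => slice N y a *m g).
  by apply: (iso_trajectory_slice _ traj) => i; have := leT i; rewrite /N; lia.
split=> // ubar ybar; split=> [[xbar trajbar]|[g]].
  have /row_freeP[G XUG] := freeXU.
  (* The right inverse [G] yields a combination with initial state [xbar 0], the only entry of
     [stack 1 xbar], and input [ubar]. *)
  pose g := G *m col_mx (stack 1 xbar) (stack L ubar).
  have : col_mx (mosaic_hankel 1 N x) (mosaic_hankel L N u) *m g =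
      col_mx (stack 1 xbar) (stack L ubar) by rewrite mulmxA XUG mul1mx.
  rewrite mul_col_mx => /eq_col_mx[xg ug]; exists g.
  rewrite mul_col_mx ug; congr col_mx; apply/stack_eq_mosaic_mulP.
  apply: (iso_trajectory_eq trajbar (sliceT g)).
    by have /stack_eq_mosaic_mulP -> := esym xg.
  exact/stack_eq_mosaic_mulP/esym.
rewrite mul_col_mx => /eq_col_mx[/stack_eq_mosaic_mulP uE /stack_eq_mosaic_mulP yE].
(* The same weights [g], applied to the recorded states, supply the missing state sequence. *)
exists (fun a => slice N x a *m g); have [xS yS] := sliceT g; split=> t ltL.
  by rewrite xS // uE // ltnW.
by rewrite yE // yS // uE.
Qed.
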